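(* Let $G$ be a connected plane graph with a perfect matching. Then the resonance graph $R(G)$ is connected if and only if $I[C]$ is an elementary bipartite graph for each nice cycle $C$ of $G$.
   Context: For a plane graph $G$, the resonance graph $R(G)$ has as vertices the perfect matchings of $G$, and two perfect matchings $M_1,M_2$ are adjacent iff $M_1\oplus M_2$ (symmetric difference) is exactly the boundary cycle of one interior (bounded) face of $G$. A cycle $C$ of $G$ is nice if $G-V(C)$ has a perfect matching (equivalently, $C$ is $M$-alternating for some perfect matching $M$ of $G$). For a cycle $C$ of a plane graph, $I[C]$ denotes the subgraph of $G$ consisting of $C$ together with everything of $G$ lying in the interior of $C$. An edge is allowed if it lies in some perfect matching; a graph is elementary if its allowed edges form a connected subgraph (for bipartite graphs: connected and every edge allowed). *)

(* Defs.v *)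
(* Plane graphs are encoded combinatorially as rotation
   systems (combinatorial maps) of genus 0 with a distinguished outer face. *)
From Stdlib Require Import Relations.
From mathcomp Require Import all_boot.
Set Implicit Arguments.
Unset Strict Implicit.
Unset Printing Implicit Defensive.

Section PlaneGraph.
Variables (V D : finType) (tail : D -> V) (a s : D -> D).

(* face permutation: traverse dart d = (u->v), then turn at v *)
Definition phi (d : D) : D := s (a d).

(* A simple, connected graph with dart set D, vertex set V, edge involution a
   (d and a d are the two orientations of one edge), rotation s at each vertex,
   embedded in the plane (Euler's formula V - E + F = 2 for connected maps). *)
Definition adjV (S : {set D}) : rel V :=
  fun u v => [exists d in S, (tail d == u) && (tail (a d) == v)].

Definition plane_graph : Prop :=
  [/\ (forall d, a (a d) = d /\ a d != d),
      (forall d, tail (a d) != tail d),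
      (forall d d', tail d = tail d' -> tail (a d) = tail (a d') -> d = d'),
      [/\ injective s,
           (forall d, tail (s d) = tail d)
         & (forall d d', tail d = tail d' -> fconnect s d d')]
    & (forall u v : V, connect (adjV setT) u v)].

Definition genus0 : Prop :=
  (2 * (#|V| + fcard phi D) = #|D| + 4)%N.

(* edge sets are represented by a-closed sets of darts *)
Definition aclosed (S : {set D}) : bool := [forall d, (a d \in S) == (d \in S)].

Definition vset (S : {set D}) : {set V} := tail @: S.

Definition degree_in (S : {set D}) (v : V) : nat := #|[set d in S | tail d == v]|.

Definition perfect_matching_of (S M : {set D}) : bool :=
  [&& M \subset S, aclosed M & [forall v in vset S, degree_in M v == 1%N]].

Definition perfect_matching (M : {set D}) : bool :=
  aclosed M && [forall v, degree_in M v == 1%N].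

Definition is_cycle (C : {set D}) : bool :=
  [&& aclosed C, C != set0,
      [forall v, (degree_in C v == 0%N) || (degree_in C v == 2%N)] &
      [forall u in vset C, forall v in vset C, connect (adjV C) u v]].

Definition nice_cycle (C : {set D}) : bool :=
  is_cycle C &&
  [exists M : {set D},
     [&& aclosed M, [forall d in M, tail d \notin vset C] &
         [forall v, (v \notin vset C) ==> (degree_in M v == 1%N)]]].

(* resonance graph: d0 is a dart of the outer face *)
Definition face_edges (d : D) : {set D} :=
  [set e | fconnect phi d e || fconnect phi d (a e)].

Definition res_adj (d0 : D) (M1 M2 : {set D}) : Prop :=
  [/\ perfect_matching M1, perfect_matching M2 &
      exists d, ~~ fconnect phi d0 d /\
                (M1 :\: M2) :|: (M2 :\: M1) = face_edges d].

Definition resonance_connected (d0 : D) : Prop :=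
  forall M1 M2, perfect_matching M1 -> perfect_matching M2 ->
    clos_refl_trans _ (res_adj d0) M1 M2.

(* I[C]: faces are glued across edges not on C; the side containing the outer
   face (dart d0) is the exterior.  I[C] consists of the edges having at least
   one dart on an interior face (i.e. C and everything inside it). *)
Definition cross (C : {set D}) : rel D :=
  fun d e => (e == phi d) || ((e == a d) && (d \notin C)).

Definition exterior (d0 : D) (C : {set D}) (d : D) : bool := connect (cross C) d0 d.

Definition interior_graph (d0 : D) (C : {set D}) : {set D} :=
  [set d | ~~ exterior d0 C d || ~~ exterior d0 C (a d)].

Definition bipartite_sub (S : {set D}) : Prop :=
  exists c : V -> bool, forall d, d \in S -> c (tail d) != c (tail (a d)).

Definition allowed_sub (S : {set D}) (d : D) : bool :=
  [exists M : {set D}, perfect_matching_of S M && (d \in M)].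

Definition elementary_sub (S : {set D}) : Prop :=
  (exists M, perfect_matching_of S M) /\
  forall u v, u \in vset S -> v \in vset S ->
    connect (adjV [set d in S | allowed_sub S d]) u v.

End PlaneGraph.

(* Main.v *)
(* Over the field with two elements, Euler's formula makes the face boundaries
   span all even edge sets: the incidence matrices of vertices and of faces have
   orthogonal row spaces, of ranks |V| - 1 and F - 1, inside a space of dimension
   |E|.  So every even edge set is the boundary of a unique set of faces avoiding
   the outer one; for a cycle C this set is its interior (Jordan).

   Necessity.  Flipping a nice cycle C by a path in the resonance graph writes C as
   a sum of resonant faces, so every interior face of C is resonant, hence even, and
   its edges are allowed in G.  Evenness of the faces makes I[C] bipartite.  Let an
   alternating arc go from a black vertex along an edge of I[C] to a white one and
   back along a perfect matching M that alternates on C.  An edge uv is allowed in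
   I[C] iff the mate of v reaches u by arcs.  If it did not, then either the set
   reached or its complement would avoid C, and a perfect matching N of G containing
   uv would permute the black vertices of that set through the mates of M, which
   contradicts that uv crosses it.

   Sufficiency.  Induct on the interior of C.  If I[C] has an edge outside C, it has
   one, e, incident with C, and all edges of I[C] are allowed, so some perfect
   matching N contains e and agrees with M outside I[C].  Neither M + N nor
   (M + C) + N contains C, so all their cycles have smaller interiors, and M and
   M + C are joined through N. *)
Require Import Defs.
From Stdlib Require Import Relations.
From mathcomp Require Import all_boot all_algebra.
From mathcomp Require Import zify.
Set Implicit Arguments.
Unset Strict Implicit.
Unset Printing Implicit Defensive.
Import GRing.Theory.

(** * Kernels, ranks and row spaces of matrices indexed by finite types *)

Section LinearAlgebra.
Local Open Scope ring_scope.
Variable F : fieldType.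

Let mx (I J : finType) (A : I -> J -> F) : 'M[F]_(#|I|, #|J|) :=
  \matrix_(i, j) A (enum_val i) (enum_val j).

Let sum_enum_val (I : finType) (G : I -> F) :
  \sum_(i < #|I|) G (enum_val i) = \sum_i G i.
Proof. by rewrite -(big_enum_val (A := I)). Qed.

(** The columns of the cokernel of [A] are admissible vectors [z], so [b] is killed by the cokernel,
    which characterizes membership in the row space. *)
Lemma fredholm_alternative (I J : finType) (A : I -> J -> F) (b : J -> F) :
  (forall z, (forall i, \sum_j A i j * z j = 0) -> \sum_j b j * z j = 0) ->
  exists x, forall j, b j = \sum_i x i * A i j.
Proof.
move=> orth; pose w : 'rV[F]_#|J| := \row_j b (enum_val j).
have /submxP[x wE] : (w <= mx A)%MS.
  rewrite submxE; apply/eqP/matrixP=> i0 k; rewrite !mxE.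
  rewrite -[RHS](orth (fun j => cokermx (mx A) (enum_rank j) k)).
    by rewrite -[RHS]sum_enum_val; apply: eq_bigr => j _; rewrite !mxE enum_valK.
  move=> i; have /matrixP/(_ (enum_rank i) k) := mulmx_coker (mx A).
  rewrite !mxE => E; rewrite -[RHS]E -[LHS]sum_enum_val; apply: eq_bigr => j _.
  by rewrite !mxE enum_valK enum_rankK.
exists (fun i => x 0 (enum_rank i)) => j.
have /matrixP/(_ 0 (enum_rank j)) := wE; rewrite !mxE enum_rankK => ->.
by rewrite -[RHS]sum_enum_val; apply: eq_bigr => i _; rewrite !mxE enum_valK enum_rankK.
Qed.

(** A left kernel made of constant vectors has dimension at most one. *)
Let rank_const (I J : finType) (A : I -> J -> F) :
  (forall x, (forall j, \sum_i x i * A i j = 0) -> forall i i', x i = x i') ->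
  (#|I| <= (\rank (mx A)).+1)%N.
Proof.
move=> cst; have : (kermx (mx A) <= (const_mx 1 : 'rV[F]_#|I|))%MS.
  apply/row_subP=> k; apply/sub_rVP.
  have cstk : forall i i', kermx (mx A) k i = kermx (mx A) k i'.
    move=> i i'.
    have := cst (fun i => kermx (mx A) k (enum_rank i)) _ (enum_val i) (enum_val i').
    rewrite !enum_valK; apply=> j.
    have /matrixP/(_ k (enum_rank j)) := mulmx_ker (mx A).
    rewrite !mxE => E; rewrite -[RHS]E -[LHS]sum_enum_val; apply: eq_bigr => l _.
    by rewrite !mxE enum_valK enum_rankK.
  exists (kermx (mx A) k k); apply/rowP=> i.
  by rewrite [LHS]mxE (cstk i k) [RHS]mxE [X in _ * X]mxE mulr1.
move/mxrankS/leq_trans/(_ (rank_leq_row _)).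
by rewrite mxrank_ker leq_subLR addn1.
Qed.

(** The rows of [B] lie in the orthogonal complement of the rows of [A]. Its dimension
    [|J| - rank A] is at most [|K| - 1], hence at most the rank of [B], so they span it. *)
Lemma dual_row_space (I K J : finType) (A : I -> J -> F) (B : K -> J -> F) :
  (forall i k, \sum_j A i j * B k j = 0) ->
  (forall x, (forall j, \sum_i x i * A i j = 0) -> forall i i', x i = x i') ->
  (forall x, (forall j, \sum_k x k * B k j = 0) -> forall k k', x k = x k') ->
  (#|I| + #|K| = #|J| + 2)%N ->
  forall z, (forall i, \sum_j A i j * z j = 0) ->
  exists f, forall j, z j = \sum_k f k * B k j.
Proof.
move=> AB /rank_const rA /rank_const rB card z Az.
have sBA : (mx B <= kermx (mx A)^T)%MS.
  apply/sub_kermxP/matrixP=> k i; rewrite !mxE -[RHS](AB (enum_val i) (enum_val k)).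
  by rewrite -[RHS]sum_enum_val; apply: eq_bigr => j _; rewrite !mxE mulrC.
have sAB : (kermx (mx A)^T <= mx B)%MS.
  have := (mxrank_leqif_sup sBA).2 => <-.
  rewrite eqn_leq mxrankS //= mxrank_ker mxrank_tr.
  have ar (i j k p q : nat) : (i <= p.+1 -> k <= q.+1 -> i + k = j + 2 ->
    j - p <= q)%N by lia.
  exact: ar rA rB card.
pose w : 'rV[F]_#|J| := \row_j z (enum_val j).
have /submxP[x wE] : (w <= mx B)%MS.
  apply: submx_trans sAB; apply/sub_kermxP/matrixP=> k i.
  rewrite !mxE -[RHS](Az (enum_val i)) -[RHS]sum_enum_val.
  by apply: eq_bigr => j _; rewrite !mxE mulrC.
exists (fun i => x 0 (enum_rank i)) => j.
have /matrixP/(_ 0 (enum_rank j)) := wE; rewrite !mxE enum_rankK => ->.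
by rewrite -[RHS]sum_enum_val; apply: eq_bigr => i _; rewrite !mxE enum_valK enum_rankK.
Qed.

End LinearAlgebra.

(** * Parities as sums in [bool], the field with two elements *)

Section FiniteParity.
Local Open Scope ring_scope.

Lemma odd_sum (I : finType) (P : pred I) (f : I -> nat) :
  odd (\sum_(i | P i) f i) = \sum_(i | P i) odd (f i) :> bool.
Proof. exact: (big_morph odd oddD). Qed.

Lemma odd_card (T : finType) (A : {set T}) : odd #|A| = \sum_x (x \in A) :> bool.
Proof.
rewrite -sum1_card odd_sum big_mkcond /=.
by apply: eq_bigr => x _; case: (x \in A).
Qed.

Lemma odd_card_cond (T : finType) (A : {set T}) (P : pred T) :
  odd #|[set x in A | P x]| = \sum_(x | P x) (x \in A) :> bool.
Proof.
rewrite odd_card [RHS]big_mkcond /=.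
by apply: eq_bigr => x _; rewrite inE; case: (x \in A); case: (P x).
Qed.

End FiniteParity.

Lemma sum_eq (I : finType) (i0 : I) (x : I -> bool) :
  (\sum_i x i * (i0 == i) = x i0)%R.
Proof.
rewrite (bigD1 i0) //= eqxx mulr1 big1 ?addr0 // => i.
by rewrite eq_sym => /negPf->; rewrite mulr0.
Qed.

(** * Walks and orbits in finite types *)

Lemma connect_exit (T : finType) (e : rel T) (P : pred T) x y :
  connect e x y -> P x -> ~~ P y -> exists u w, [/\ P u, ~~ P w & e u w].
Proof.
case/connectP=> p; elim: p x => /= [x _ -> -> //|w p IHp x /andP[exw ep] yE Px NPy].
have [Pw|NPw] := boolP (P w); first exact: IHp Pw NPy.
by exists x, w.
Qed.

Lemma connect_invariant (T : finType) (S : eqType) (e : rel T) (f : T -> S) x y :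
  (forall u w, e u w -> f u = f w) -> connect e x y -> f x = f y.
Proof.
move=> fe /connectP[p]; elim: p x => /= [x _ -> //|w p IHp x /andP[/fe-> ep]].
exact: IHp.
Qed.

(** An injective map of a finite type is a permutation, so the orbit of [f x] comes back to [x]. The
    arguments that compose two matchings rest on this. *)
Lemma inj_closed_backward (T : finType) (f : T -> T) (P : pred T) x :
  injective f -> (forall y, P y -> P (f y)) -> P (f x) -> P x.
Proof.
move=> fI cl Pfx; have : fconnect f (f x) x by rewrite (fconnect_sym fI) fconnect1.
case/connectP=> p; elim: p (f x) Pfx => [y Py _ ->//|z p IHp y /cl Py /=].
by case/andP=> /eqP<-; apply: IHp.
Qed.

Lemma connect_map (T T' : finType) (e : rel T) (e' : rel T') (f : T -> T') x y :
  (forall u w, e u w -> connect e' (f u) (f w)) -> connect e x y -> connect e' (f x) (f y).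
Proof.
move=> ee' /connectP[p]; elim: p x => /= [x _ -> //|w p IHp x /andP[/ee' exw ep] yE].
exact: connect_trans exw (IHp w ep yE).
Qed.

(** * Darts, rotations and sums over the edges of a plane map *)

Section Plane.
Variables (V D : finType) (tail : D -> V) (a s : D -> D) (d0 : D).
Hypothesis planeG : plane_graph tail a s.
Hypothesis genusG : genus0 V a s.

Notation phi := (phi a s).
Notation aclosed := (aclosed a).
Notation degree_in := (degree_in tail).
Notation vset := (vset tail).

Lemma aK : involutive a. Proof. by case: planeG => h _ _ _ _ d; case: (h d). Qed.
Lemma a_neq d : a d != d. Proof. by case: planeG => h _ _ _ _; case: (h d). Qed.
Lemma a_inj : injective a. Proof. exact: inv_inj aK. Qed.
Lemma dart_eq d d' : tail d = tail d' -> tail (a d) = tail (a d') -> d = d'.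
Proof. by case: planeG => _ _ h _ _; apply: h. Qed.
Lemma s_inj : injective s. Proof. by case: planeG => _ _ _ []. Qed.
Lemma tail_s d : tail (s d) = tail d. Proof. by case: planeG => _ _ _ []. Qed.
Lemma s_transitive d d' : tail d = tail d' -> fconnect s d d'.
Proof. by case: planeG => _ _ _ [_ _ h] _; apply: h. Qed.
Lemma connectG u v : connect (adjV tail a setT) u v. Proof. by case: planeG. Qed.
Lemma phi_inj : injective phi. Proof. exact: inj_comp s_inj a_inj. Qed.
Lemma phi_a d : phi (a d) = s d. Proof. by rewrite /Defs.phi aK. Qed.

Lemma aclosedE S d : aclosed S -> (a d \in S) = (d \in S).
Proof. by move/forallP/(_ d)/eqP. Qed.

Lemma adjVP (S : {set D}) u v :
  reflect (exists2 d, d \in S & tail d = u /\ tail (a d) = v) (adjV tail a S u v).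
Proof.
apply: (iffP existsP) => [[d /and3P[dS /eqP<- /eqP<-]]|[d dS [<- <-]]]; exists d => //.
by rewrite dS !eqxx.
Qed.

(** Invariance under [s] makes [f] a function of the vertex; invariance under [a] and connectedness
    then make it constant. *)
Lemma connect_const (T : eqType) (f : D -> T) :
  (forall d, f (s d) = f d) -> (forall d, f (a d) = f d) -> forall d d', f d = f d'.
Proof.
move=> fs fa d d'.
have fV e e' : tail e = tail e' -> f e = f e'.
  by move/s_transitive; apply: connect_invariant => u w /eqP<-; apply/esym/fs.
(* The default [f d] only concerns vertices that carry no dart. *)
pose g v := if [pick e | tail e == v] is Some e then f e else f d.
have gE e' : g (tail e') = f e'.
  rewrite /g; case: pickP => [e2 /eqP/fV //|/(_ e')]; by rewrite eqxx.
rewrite -!gE; apply: connect_invariant (connectG _ _) => u w /adjVP[c _ [<- <-]].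
by rewrite !gE fa.
Qed.

Local Open Scope ring_scope.

(* One dart per edge. *)
Definition rep (d : D) : bool := (enum_rank d < enum_rank (a d))%N.

Lemma rep_a d : rep (a d) = ~~ rep d.
Proof.
rewrite /rep aK ltnNge leq_eqVlt -/(rep d); congr (~~ _).
case: eqP => // /val_inj/enum_rank_inj/esym/eqP.
by rewrite (negPf (a_neq d)).
Qed.

Lemma sum_rep (R : nmodType) (g : D -> R) :
  \sum_d g d = \sum_(d | rep d) (g d + g (a d)).
Proof.
rewrite (bigID rep) big_split /=; congr (_ + _).
rewrite (reindex_inj a_inj) /=; apply: eq_bigl => d.
by rewrite rep_a negbK.
Qed.

Lemma odd_aclosed (S : {set D}) : aclosed S -> odd #|S| = false.
Proof.
move=> aS; rewrite odd_card sum_rep big1 // => d _.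
by rewrite aclosedE //; apply: addbb.
Qed.

Lemma pairing_rep (x g : D -> bool) : (forall d, g (a d) = g d) ->
  \sum_(d | rep d) (x d + x (a d)) * g d = \sum_d x d * g d.
Proof.
move=> ga; rewrite sum_rep; apply: eq_bigr => d _.
by rewrite ga mulrDl.
Qed.

(** Vertices are orthogonal to faces: reindexing by [s] turns [f d] into [f (s d)], and [s d] lies
    on the same face as [a d], so the terms cancel in pairs. *)
Lemma sum_boundary_at (f : D -> bool) v : (forall d, f (phi d) = f d) ->
  \sum_(d | tail d == v) (f d + f (a d)) = 0.
Proof.
move=> fphi; rewrite big_split /= [X in X + _](reindex_inj s_inj) /=.
rewrite [X in X + _](eq_bigl (fun d => tail d == v)); last by move=> d; rewrite tail_s.
rewrite -big_split big1 //= => d _.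
by rewrite -phi_a fphi; apply: addbb.
Qed.

(** * Face boundaries *)

Definition even_set (z : {set D}) : Prop := forall v, ~~ odd (degree_in z v).

(** For [f] constant on faces, this is the boundary over the field with two elements of a set of
    faces. *)
Definition bd (f : D -> bool) : {set D} := [set d | f d (+) f (a d)].

Lemma in_bd f d : (d \in bd f) = f d (+) f (a d). Proof. by rewrite in_set. Qed.

Lemma bd_aclosed f : aclosed (bd f).
Proof. by apply/forallP=> d; rewrite !inE aK addbC. Qed.

Lemma bd_even f : (forall d, f (phi d) = f d) -> even_set (bd f).
Proof.
move=> fphi v; rewrite odd_card_cond.
under eq_bigr do rewrite inE.
by rewrite sum_boundary_at.
Qed.

(** The sum [h] of the two face sets takes equal values on the two sides of every edge, so it is
    constant, and it vanishes at [d0]. *)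
Lemma bd_inj f g : (forall d, f (phi d) = f d) -> (forall d, g (phi d) = g d) ->
  f d0 = g d0 -> bd f = bd g -> f =1 g.
Proof.
move=> fphi gphi fg0 E d; apply: addbI (g d) _ _ _; rewrite addbb.
pose h d := g d (+) f d; rewrite -/(h d).
suff -> : h d = h d0 by rewrite /h fg0 addbb.
have ha e : h (a e) = h e.
  have /setP/(_ e) := E; rewrite !inE /h.
  by case: (f e); case: (f (a e)); case: (g e); case: (g (a e)).
apply: (connect_const _ ha) => e.
by rewrite -phi_a -[RHS]ha /h fphi gphi.
Qed.

Lemma card_rep : (#|{: {d | rep d}}| * 2 = #|D|)%N.
Proof.
rewrite card_sig -[RHS]sum1_card sum_rep -sum1_card big_distrl /=.
by apply: eq_big => d; rewrite ?inE.
Qed.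

Lemma sum_sig (P : pred D) (g : D -> bool) :
  \sum_(j : {d | P d}) g (val j) = \sum_(d | P d) g d.
Proof. by rewrite -(big_sub P). Qed.

Lemma froot_phi_invariant (f : D -> bool) : (forall d, f (phi d) = f d) ->
  forall d, f (froot phi d) = f d.
Proof.
move=> fphi d; apply/esym; apply: (connect_invariant _ (connect_root _ d)) => u w /eqP<-.
exact/esym.
Qed.

Lemma froot_phi d : froot phi (phi d) = froot phi d.
Proof. by apply/esym/eqP; rewrite (root_connect (fconnect_sym phi_inj)) fconnect1. Qed.

Let face : finType := {d | froots phi d}.

Let face_of d : face := 
  exist (fun d => is_true (froots phi d)) _ (roots_root (fconnect_sym phi_inj) d).

Let face_of_phi d : face_of (phi d) = face_of d.
Proof. by apply: val_inj; rewrite /= froot_phi. Qed.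

(** This is [dual_row_space] for the vertex-edge and face-edge incidence matrices. Connectedness
    makes both left kernels constant, and Euler's formula gives the dimension count. *)
Lemma even_set_bd (z : {set D}) : aclosed z -> even_set z ->
  exists f : D -> bool, [/\ forall d, f (phi d) = f d, f d0 = false & z = bd f].
Proof.
move=> az ez.
pose A v (j : {d | rep d}) : bool := (tail (val j) == v) + (tail (a (val j)) == v).
(* The sum is taken in [bool], so an edge with one face on both sides has only zero entries. *)
pose B (k : face) (j : {d | rep d}) : bool :=
  (face_of (val j) == k) + (face_of (a (val j)) == k).
have AB v k : \sum_j A v j * B k j = 0.
  rewrite /A /B (sum_sig _ (fun d => ((tail d == v) + (tail (a d) == v)) *
    ((face_of d == k) + (face_of (a d) == k)))).
  rewrite (@pairing_rep (fun d => tail d == v)); last by move=> d; rewrite aK addrC.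
  rewrite -[RHS](@sum_boundary_at (fun d => face_of d == k) v) => [|d]; last by rewrite face_of_phi.
  rewrite [RHS]big_mkcond; apply: eq_bigr => d _.
  by case: (tail d == v); rewrite ?mul0r ?mul1r.
have kerA x : (forall j, \sum_v x v * A v j = 0) -> forall u v, x u = x v.
  move=> xA u v.
  have xr d : rep d -> x (tail d) = x (tail (a d)).
    move=> rd; have := xA (exist (fun d => is_true (rep d)) d rd); rewrite /A /=.
    under eq_bigr do rewrite mulrDr.
    rewrite big_split /= !sum_eq => /eqP; rewrite addr_eq0 => /eqP->.
    by case: (x _).
  apply: connect_invariant (connectG u v) => {}u {}v /adjVP[d _ [<- <-]].
  have [/xr//|] := boolP (rep d).
  by rewrite -rep_a => /xr; rewrite aK.
have kerB x : (forall j, \sum_k x k * B k j = 0) -> forall k k', x k = x k'.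
  move=> xB k k'.
  have xr d : rep d -> x (face_of d) = x (face_of (a d)).
    move=> rd; have := xB (exist (fun d => is_true (rep d)) d rd); rewrite /B /=.
    under eq_bigr do rewrite mulrDr.
    rewrite big_split /= !sum_eq => /eqP; rewrite addr_eq0 => /eqP->.
    by case: (x _).
  have xa d : x (face_of (a d)) = x (face_of d).
    have [/xr//|] := boolP (rep d).
    by rewrite -rep_a => /xr; rewrite aK.
  have kE (k1 : face) : k1 = face_of (val k1).
    by apply: val_inj => /=; apply/esym/eqP/(valP k1).
  rewrite (kE k) (kE k'); apply: (@connect_const _ (fun d => x (face_of d))) => // d.
  by rewrite -phi_a face_of_phi.
have card : (#|V| + #|face| = #|{: {d | rep d}}| + 2)%N.
  have -> : #|face| = fcard phi D.
    by rewrite card_sig; apply: eq_card => d; rewrite !inE andbT.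
  have ar (v f r d : nat) : (2 * (v + f) = d + 4 -> r * 2 = d -> v + f = r + 2)%N by lia.
  exact: ar genusG card_rep.
have [|x xE] := dual_row_space AB kerA kerB card (z := fun j => val j \in z).
  move=> v; rewrite /A (sum_sig _ (fun d => ((tail d == v) + (tail (a d) == v)) * (d \in z))).
  rewrite (@pairing_rep (fun d => tail d == v)); last by move=> d; rewrite aclosedE.
  have /negPf := ez v; rewrite odd_card_cond big_mkcond => E; rewrite -[RHS]E.
  by apply: eq_bigr => d _; case: (tail d == v); rewrite ?mul0r ?mul1r.
(* Adding the constant [x (face_of d0)] keeps the boundary and excludes the outer face. *)
pose f d := x (face_of d) (+) x (face_of d0); exists f; split.
- by move=> d; rewrite /f face_of_phi.
- exact: addbb.
have zr d : rep d -> (d \in z) = f d (+) f (a d).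
  move=> rd; have := xE (exist (fun d => is_true (rep d)) d rd); rewrite /B /= => ->.
  under eq_bigr do rewrite mulrDr.
  rewrite big_split /= !sum_eq /f.
  by case: (x _); case: (x _); case: (x _).
apply/setP=> d; rewrite inE; have [/zr//|] := boolP (rep d).
by rewrite -rep_a => /zr; rewrite aK aclosedE // addbC.
Qed.

Local Close Scope ring_scope.

(** * Cycles and their interiors *)

Lemma mem_vset (S : {set D}) d : d \in S -> tail d \in vset S.
Proof. exact: imset_f. Qed.

Lemma degree_gt0 (S : {set D}) v : (0 < degree_in S v) = (v \in vset S).
Proof.
apply/card_gt0P/imsetP => [[d]|[d dS ->]]; last by exists d; rewrite !inE dS eqxx.
by rewrite !inE => /andP[dS /eqP<-]; exists d.
Qed.

Lemma cycle_aclosed C : is_cycle tail a C -> aclosed C. Proof. by case/and4P. Qed.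

Lemma cycle_degree C v : is_cycle tail a C -> v \in vset C -> degree_in C v = 2.
Proof.
case/and4P=> _ _ /forallP/(_ v)/orP[/eqP d0v|/eqP//] _.
by rewrite -degree_gt0 d0v.
Qed.

Lemma cycle_degree0 C v : v \notin vset C -> degree_in C v = 0.
Proof. by rewrite -degree_gt0 lt0n negbK => /eqP. Qed.

Lemma cycle_connect C u v : is_cycle tail a C -> u \in vset C -> v \in vset C ->
  connect (adjV tail a C) u v.
Proof.
by case/and4P=> _ _ _ /forall_inP h uC vC; have /forall_inP/(_ v vC) := h u uC.
Qed.

Lemma cycle_even C : is_cycle tail a C -> even_set C.
Proof.
by case/and4P=> _ _ /forallP h _ v; case/orP: (h v) => /eqP->.
Qed.

(** Inside [C], an even degree is 0 or 2, so [z] contains all darts of [C] at each vertex that it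
    meets; connectedness of [C] spreads this along the cycle. *)
Lemma cycle_minimal C (z : {set D}) : is_cycle tail a C -> aclosed z -> z \subset C ->
  even_set z -> z != set0 -> z = C.
Proof.
move=> cC az sz ez /set0Pn[e ez0].
have full v d : v \in vset z -> d \in C -> tail d = v -> d \in z.
  move=> vz dC dv.
  have sub : [set d in z | tail d == v] \subset [set d in C | tail d == v].
    by apply/subsetP=> c; rewrite !inE => /andP[/(subsetP sz)-> ->].
  have vC : v \in vset C by rewrite -dv mem_vset.
  have := cycle_degree cC vC; rewrite /Defs.degree_in => E.
  have : [set d in z | tail d == v] == [set d in C | tail d == v].
    rewrite eqEcard sub E; move: (ez v); rewrite -degree_gt0 in vz.
    by move: vz; rewrite /Defs.degree_in; case: #|_| => [|[|]].
  by move/eqP/setP/(_ d); rewrite !inE dC dv eqxx => /andP[].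
apply/eqP; rewrite eqEsubset sz; apply/subsetP=> c cC0.
apply: (full (tail c)) => //; apply: contraT => nzc.
have [u [w [uz nwz /adjVP[d dC [du dw]]]]] :=
  connect_exit (P := [in vset z]) (cycle_connect cC (mem_vset (subsetP sz _ ez0)) (mem_vset cC0))
    (mem_vset ez0) nzc.
case/negP: nwz; rewrite -dw; apply: mem_vset.
by rewrite aclosedE //; apply: full uz dC du.
Qed.

Section Interior.
Variable C : {set D}.
Hypothesis cycC : is_cycle tail a C.

Notation ext := (exterior a s d0 C).
Notation H := (interior_graph a s d0 C).

Lemma ext_phi d : ext (phi d) = ext d.
Proof.
apply/idP/idP=> e; apply: connect_trans e _; last by apply: connect1; rewrite /cross eqxx.
have : fconnect phi (phi d) d by rewrite (fconnect_sym phi_inj) fconnect1.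
by apply: connect_sub => u w /eqP<-; apply: connect1; rewrite /cross eqxx.
Qed.

Lemma ext_a d : d \notin C -> ext (a d) = ext d.
Proof.
have aC := cycle_aclosed cycC.
suff h c : c \notin C -> ext c -> ext (a c).
  move=> dC; apply/idP/idP => [|/h->//]; rewrite -{2}[d]aK; apply: h.
  by rewrite aclosedE.
move=> cC e; apply: connect_trans e _; apply: connect1.
by rewrite /cross eqxx cC orbT.
Qed.

Lemma ext_d0 : ext d0. Proof. exact: connect0. Qed.

Lemma ext_const (f : D -> bool) : (forall d, f (phi d) = f d) ->
  (forall d, d \notin C -> f (a d) = f d) -> forall d, ext d -> f d = f d0.
Proof.
move=> fphi fa d /(connect_invariant (f := f)) -> // u w.
by case/orP=> [/eqP->|/andP[/eqP-> /fa->]].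
Qed.

(** The boundary of the exterior is an even subset of [C], so it is [C] or empty. If it were empty,
    all darts would be exterior, and a face set with boundary [C] would be constant, forcing [C] to
    be empty. *)
Lemma jordan : bd ext = C.
Proof.
have aC := cycle_aclosed cycC.
have sub : bd ext \subset C.
  apply/subsetP=> d; rewrite inE; apply: contraLR => /ext_a->.
  by rewrite addbb.
apply: cycle_minimal (bd_aclosed _) sub (bd_even ext_phi) _ => //.
apply: contraTneq isT => E.
have extT d : ext d.
  by rewrite (bd_inj (g := xpredT) ext_phi _ ext_d0) // E; apply/setP=> e; rewrite !inE.
have [f [fphi _ CE]] := even_set_bd aC (cycle_even cycC).
have fC d : f d = f d0.
  apply: ext_const => // c; rewrite CE inE.
  by case: (f c); case: (f (a c)).
have := cycC; case/and4P=> _ /set0Pn[c]; rewrite CE inE !fC.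
by rewrite addbb.
Qed.

Lemma mem_cycle d : (d \in C) = ext d (+) ext (a d).
Proof. by rewrite -{1}jordan inE. Qed.

Lemma interior_aclosed : aclosed H.
Proof. by apply/forallP=> d; rewrite !inE aK orbC. Qed.

Lemma cycle_sub_interior : C \subset H.
Proof.
by apply/subsetP=> d; rewrite mem_cycle inE; case: (ext d); case: (ext (a d)).
Qed.

Lemma mem_interior d : d \notin C -> (d \in H) = ~~ ext d.
Proof. by move=> /ext_a E; rewrite inE E orbb. Qed.

(** Turning around a vertex off [C] passes from face to face across edges off [C] only. *)
Lemma ext_tail d e : tail d \notin vset C -> tail e = tail d -> ext e = ext d.
Proof.
move=> dC; move/esym/s_transitive => h; apply/esym.
have tC x y : fconnect s x y -> tail x = tail y.
  by apply: connect_invariant => u w /eqP<-; rewrite tail_s.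
case/connectP: h => p; elim: p d dC => [d _ _ ->//|x p IHp d dC /= /andP[/eqP sd sp] eE].
have dx : tail x = tail d by rewrite -sd tail_s.
rewrite -(IHp x) ?dx // -sd -phi_a ext_phi ext_a //.
by apply: contra dC; apply: mem_vset.
Qed.

Lemma interior_tail d e : tail d \notin vset C -> tail e = tail d ->
  (e \in H) = (d \in H).
Proof.
move=> dC ed.
have nC c : tail c = tail d -> c \notin C.
  by move=> cd; apply: contra dC => /mem_vset; rewrite cd.
by rewrite !mem_interior ?nC // (ext_tail dC ed).
Qed.

Lemma interior_vset d : tail d \notin vset C -> (tail d \in vset H) = (d \in H).
Proof.
move=> dC; apply/idP/idP=> [/imsetP[e eH de]|/mem_vset//].
by rewrite (@interior_tail e) // -de.
Qed.

(** A component of [I[C]] that missed [C] would be left by an edge of [G] at a vertex off [C]; but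
    all edges at such a vertex belong to [I[C]]. *)
Lemma interior_connected u v : u \in vset H -> v \in vset H ->
  connect (adjV tail a H) u v.
Proof.
have sym : connect_sym (adjV tail a H).
  apply: sym_connect_sym => x y; apply/adjVP/adjVP => -[d dH [<- <-]];
    by exists (a d); rewrite ?aK // aclosedE // interior_aclosed.
have [c cC] : exists c, c \in C by case/and4P: cycC => _ /set0Pn.
suff h w : w \in vset H -> connect (adjV tail a H) w (tail c).
  by move=> /h uc /h vc; apply: connect_trans uc _; rewrite sym.
move=> wH; apply: contraT => nwc.
pose K x := connect (adjV tail a H) w x.
have nKC x : x \in vset C -> ~~ K x.
  move=> xC; apply: contra nwc => /connect_trans; apply.
  apply: connect_sub (cycle_connect cycC xC (mem_vset cC)) => y z /adjVP[d dC dE].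
  by apply: connect1; apply/adjVP; exists d => //; apply: (subsetP cycle_sub_interior).
have [u' [v' [Ku nKv /adjVP[d _ [du dv]]]]] :=
  connect_exit (P := K) (connectG w (tail c)) (connect0 _ _) (nKC _ (mem_vset cC)).
case/negP: nKv; apply: (connect_trans Ku); apply: connect1; apply/adjVP; exists d => //.
have uC : tail d \notin vset C by apply: contraL Ku => /nKC; rewrite -du.
rewrite -interior_vset //.
have KH x : K x -> x \in vset H.
  move/(connect_invariant (f := fun y => y \in vset H)) => <- // y z.
  case/adjVP=> e eH [<- <-]; rewrite !mem_vset //.
  by rewrite aclosedE // interior_aclosed.
by apply: KH; rewrite du.
Qed.

End Interior.

(** * Matchings and alternating arcs *)

Lemma degree1I (M : {set D}) v e : e \in M -> tail e = v ->
  (forall e', e' \in M -> tail e' = v -> e' = e) -> degree_in M v = 1.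
Proof.
move=> eM ev uniq; rewrite /Defs.degree_in -(cards1 e); congr #|pred_of_set _|.
apply/setP=> d; rewrite !inE; apply/andP/eqP=> [[dM /eqP dv]|->]; first exact: uniq.
by rewrite ev eqxx.
Qed.

Lemma degree1E (M : {set D}) v : degree_in M v = 1 ->
  exists e, [/\ e \in M, tail e = v & forall e', e' \in M -> tail e' = v -> e' = e].
Proof.
move/eqP/cards1P=> [e /setP eE]; exists e.
have := eE e; rewrite !inE eqxx => /andP[eM /eqP ev]; split=> // e' e'M e'v.
by have := eE e'; rewrite !inE e'M e'v eqxx => /esym/eqP.
Qed.

Definition matching (M : {set D}) := aclosed M /\ forall v, v \in vset M -> degree_in M v = 1.

Lemma matching_uniq M d e : matching M -> d \in M -> e \in M -> tail d = tail e -> d = e.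
Proof.
move=> [_ M1] dM eM de; have [f [_ _ u]] := degree1E (M1 _ (mem_vset dM)).
by rewrite (u d) // (u e).
Qed.

Lemma perfect_matching_vset M : perfect_matching tail a M -> vset M = setT.
Proof.
case/andP=> _ /forallP M1; apply/setP=> v; rewrite inE.
by rewrite -degree_gt0 (eqP (M1 v)).
Qed.

Lemma perfect_matchingW M : perfect_matching tail a M -> matching M.
Proof. by case/andP=> aM /forallP M1; split=> // v _; apply/eqP. Qed.

Lemma perfect_matching_of_vset S M : perfect_matching_of tail a S M -> vset M = vset S.
Proof.
case/and3P=> sMS _ /forall_inP M1; apply/eqP.
rewrite eqEsubset imsetS //=; apply/subsetP=> v /M1/eqP.
by rewrite -degree_gt0 => ->.
Qed.

Lemma perfect_matching_ofW S M : perfect_matching_of tail a S M -> matching M.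
Proof.
move=> pM; have vE := perfect_matching_of_vset pM.
case/and3P: pM => sMS aM /forall_inP M1; split=> // v; rewrite vE => /M1/eqP//.
Qed.

(** Fixing the vertices outside [M] makes [mate M] an involution of all of [V], hence injective. *)
Definition mate (M : {set D}) (v : V) : V :=
  if [pick d in M | tail d == v] is Some d then tail (a d) else v.

Lemma mateE M d : matching M -> d \in M -> mate M (tail d) = tail (a d).
Proof.
move=> mM dM; rewrite /mate; case: pickP => [e /andP[eM /eqP ed]|/(_ d)].
  by rewrite (matching_uniq mM eM dM ed).
by rewrite dM eqxx.
Qed.

Lemma mate_out M v : v \notin vset M -> mate M v = v.
Proof.
move=> vM; rewrite /mate; case: pickP => // e /andP[eM /eqP ev].
by case/negP: vM; rewrite -ev mem_vset.
Qed.

Lemma mateK M : matching M -> involutive (mate M).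
Proof.
move=> mM v; have [/imsetP[d dM ->]|vM] := boolP (v \in vset M); last by rewrite !mate_out.
rewrite (mateE mM dM) (mateE mM) ?aK // aclosedE //; by case: mM.
Qed.

Lemma mate_inj M : matching M -> injective (mate M).
Proof. by move/mateK/inv_inj. Qed.

Section Alternation.
Variables (S : {set D}) (c : V -> bool) (M : {set D}).
Hypothesis aS : aclosed S.
Hypothesis cS : forall d, d \in S -> c (tail d) != c (tail (a d)).
Hypothesis pM : perfect_matching_of tail a S M.

Let mM := perfect_matching_ofW pM.

(* An arc is a step along an edge of S from a black vertex to a white one,
   followed by the edge of M at that white vertex. *)
Definition alt : rel V := fun u w => c u && adjV tail a S u (mate M w).

(** At a vertex of [S], this represents the edge of [M] there by its black end, so that arcs link
    edges of [M]. *)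
Definition black_end v := if c v then v else mate M v.

Lemma color_a d : d \in S -> c (tail (a d)) = ~~ c (tail d).
Proof. by move=> /cS; case: (c _); case: (c _). Qed.

Lemma mate_color v : v \in vset S -> c (mate M v) = ~~ c v.
Proof.
rewrite -(perfect_matching_of_vset pM) => /imsetP[d dM ->].
by rewrite (mateE mM dM) color_a //; case/and3P: pM => /subsetP->.
Qed.

Lemma mate_vset v : v \in vset S -> mate M v \in vset S.
Proof.
rewrite -(perfect_matching_of_vset pM) => /imsetP[d dM ->].
by rewrite (mateE mM dM) mem_vset // aclosedE //; case: mM.
Qed.

Lemma alt_edge d : d \in S -> c (tail d) -> alt (tail d) (mate M (tail (a d))).
Proof.
by move=> dS cd; rewrite /alt cd mateK //; apply/adjVP; exists d.
Qed.

Lemma alt_black u w : alt u w -> c w && (w \in vset S).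
Proof.
case/andP=> cu /adjVP[d dS [du dw]]; rewrite -(mateK mM w) -dw.
have aS' : tail (a d) \in vset S by rewrite mem_vset // aclosedE.
by rewrite mate_vset // mate_color // color_a // du cu.
Qed.

(** Let [N] contain [d]. The black vertices reached from the mate of the white end of [d] are closed
    under [mate M] after [mate N], an injective map that sends [tail d] to the starting point; so
    [tail d] is reached too. *)
Lemma allowed_alt d : allowed_sub tail a S d -> c (tail d) ->
  connect alt (mate M (tail (a d))) (tail d).
Proof.
case/existsP=> N /andP[pN dN] cd; have mN := perfect_matching_ofW pN.
have [sNS _ _] := and3P pN.
pose P w := [&& c w, w \in vset S & connect alt (mate M (tail (a d))) w].
have piE : mate M (mate N (tail d)) = mate M (tail (a d)) by rewrite (mateE mN dN).
have dS := subsetP sNS _ dN.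
suff /and3P[] : P (tail d) by [].
apply: (inj_closed_backward (inj_comp (mate_inj mM) (mate_inj mN))) => /= [w|].
  case/and3P=> cw; rewrite -{1}(perfect_matching_of_vset pN) => /imsetP[e eN we] cuw.
  have eS := subsetP sNS _ eN.
  have arc : alt w (mate M (mate N w)).
    by rewrite we (mateE mN eN); apply: alt_edge; rewrite -?we.
  rewrite /P; have /andP[-> ->] := alt_black arc.
  exact: connect_trans cuw (connect1 arc).
by rewrite piE /P connect0; have /andP[-> ->] := alt_black (alt_edge dS cd).
Qed.

(** The arc of [d] closes the path into an alternating cycle; shifting [M] along it gives a perfect
    matching [N] of [S] through [d]. *)
Lemma alt_allowed d : d \in S -> c (tail d) ->
  connect alt (mate M (tail (a d))) (tail d) -> allowed_sub tail a S d.
Proof.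
move=> dS cd /connectP[p0 ep0 lp0].
have arc := alt_edge dS cd.
(* Shortening removes repeated vertices, so that [next] and [prev] on [q] are mutually inverse. *)
move: lp0; case/shortenP: ep0 => p ep up _ lp.
set u' := mate M _ in ep up lp arc; pose q := u' :: p; pose pi := next q.
have cq : cycle alt q by rewrite /q /= rcons_path ep -lp.
have piK : cancel pi (prev q) by apply: prev_next.
have Kpi : cancel (prev q) pi by apply: next_prev.
have qblack x : x \in q -> c x by move=> /(next_cycle cq)/andP[].
have edge x : c x -> x \in vset S ->
    exists2 e, e \in S & tail e = x /\ tail (a e) = mate M (pi x).
  move=> cx xS; have [/(next_cycle cq)/andP[_ /adjVP//]|xq] := boolP (x \in q).
  (* [next] fixes what is not in the list, so off the cycle [N] keeps the edges of [M]. *)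
  have -> : pi x = x by rewrite /pi next_nth (negPf xq).
  move: xS; rewrite -(perfect_matching_of_vset pM) => /imsetP[e eM ->].
  by exists e; [case/and3P: pM => /subsetP->|rewrite (mateE mM eM)].
have prevP x : c x -> x \in vset S -> c (prev q x) && (prev q x \in vset S).
  move=> cx xS; have [xq|xq] := boolP (x \in q); last first.
    by rewrite prev_nth (negPf xq) cx.
  have /andP[-> /adjVP[e eS [<- _]]] := prev_cycle cq xq.
  by rewrite mem_vset.
pose N := [set e in S | if c (tail e) then tail (a e) == mate M (pi (tail e))
                        (* Both branches state the condition at the black end of the edge, which
                           makes [N] closed under [a]. *)
                        else tail e == mate M (pi (tail (a e)))].
have aN : aclosed N.
  apply/forallP=> e; rewrite !inE aclosedE // aK.
  by case eS: (e \in S); rewrite //= color_a //; case: (c (tail e)).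
have pivu : pi (tail d) = u'.
  suff <- : prev q u' = tail d by rewrite Kpi.
  rewrite prev_nth inE eqxx /=; have /andP[u'p _] := up.
  by rewrite (memNindex u'p) nth_last.
apply/existsP; exists N; apply/andP; split; last first.
  by rewrite inE dS cd pivu (mateK mM) eqxx.
rewrite /perfect_matching_of aN; apply/and3P; split=> //.
  by apply/subsetP=> e; rewrite inE => /andP[].
apply/forall_inP=> v vS; apply/eqP; case cv: (c v).
  have [e eS [ev eE]] := edge v cv vS.
  apply: (degree1I (e := e)) => //; first by rewrite inE eS ev cv eE eqxx.
  move=> e'; rewrite inE => /andP[_] + e'v; rewrite e'v cv => /eqP e'E.
  by apply: dart_eq; rewrite ?ev ?eE.
have /andP[cw wS] : c (prev q (mate M v)) && (prev q (mate M v) \in vset S).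
  by apply: prevP; rewrite ?mate_vset // mate_color // cv.
have [e eS [ew eE]] := edge _ cw wS; rewrite Kpi mateK // in eE.
apply: (degree1I (e := a e)) => //.
  by rewrite aclosedE // inE eS ew cw Kpi mateK // eE eqxx.
move=> e'; rewrite inE => /andP[e'S] + e'v; rewrite e'v cv => /eqP vE.
apply: dart_eq; rewrite ?e'v ?aK // ew -(piK (tail (a e'))).
by rewrite [in RHS]vE mateK.
Qed.

Lemma allowed_a d : allowed_sub tail a S d -> allowed_sub tail a S (a d).
Proof.
case/existsP=> N /andP[pN dN]; apply/existsP; exists N; rewrite pN aclosedE //.
by case/and3P: pN.
Qed.

(** An allowed edge can be followed both ways: from black to white by its own arc, from white to
    black by [allowed_alt]. *)
Lemma allowed_black_end u v :
  connect (adjV tail a [set d in S | allowed_sub tail a S d]) u v ->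
  connect alt (black_end u) (black_end v).
Proof.
apply: connect_map => {}u {}v /adjVP[d]; rewrite inE => /andP[dS dA] [<- <-].
rewrite /black_end color_a //; case: ifP => cd /=.
  exact/connect1/alt_edge.
by have := allowed_alt (allowed_a dA); rewrite color_a // cd aK; apply.
Qed.

(** A walk of allowed edges from the white end of an edge to its black end becomes the path of arcs
    required by [alt_allowed]. *)
Lemma connected_allowed :
  (forall u v, u \in vset S -> v \in vset S ->
    connect (adjV tail a [set d in S | allowed_sub tail a S d]) u v) ->
  forall d, d \in S -> allowed_sub tail a S d.
Proof.
move=> conn.
have black d : d \in S -> c (tail d) -> allowed_sub tail a S d.
  move=> dS cd; apply: alt_allowed => //.
  have adS : tail (a d) \in vset S by rewrite mem_vset // aclosedE.
  have := allowed_black_end (conn _ _ adS (mem_vset dS)).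
  by rewrite /black_end color_a // cd.
move=> d dS; have [|cd] := boolP (c (tail d)); first exact: black.
by rewrite -[d]aK; apply/allowed_a/black; rewrite ?aclosedE // color_a.
Qed.

End Alternation.

(** * Flipping alternating cycles *)

Definition symdiff (A B : {set D}) : {set D} := (A :\: B) :|: (B :\: A).

Lemma in_symdiff A B d : (d \in symdiff A B) = (d \in A) (+) (d \in B).
Proof. by rewrite !inE; case: (d \in A); case: (d \in B). Qed.

Lemma symdiff_aclosed A B : aclosed A -> aclosed B -> aclosed (symdiff A B).
Proof. by move=> aA aB; apply/forallP=> d; rewrite !in_symdiff !aclosedE. Qed.

Lemma symdiffC A B : symdiff A B = symdiff B A.
Proof. by rewrite /symdiff setUC. Qed.

Lemma symdiffK A B : symdiff A (symdiff A B) = B.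
Proof. by apply/setP=> d; rewrite !in_symdiff; case: (d \in A); case: (d \in B). Qed.

Lemma perfect_dart M v : perfect_matching tail a M ->
  exists e, [/\ e \in M, tail e = v & forall e', e' \in M -> tail e' = v -> e' = e].
Proof. by case/andP=> _ /forallP M1; apply/degree1E/eqP. Qed.

Lemma perfect_uniq M d e : perfect_matching tail a M -> d \in M -> e \in M ->
  tail d = tail e -> d = e.
Proof. by move/perfect_matchingW; apply: matching_uniq. Qed.

Lemma perfect_aclosed M : perfect_matching tail a M -> aclosed M.
Proof. by case/andP. Qed.

Lemma perfectI M : aclosed M ->
  (forall v, exists e, [/\ e \in M, tail e = v & forall e', e' \in M -> tail e' = v -> e' = e]) ->
  perfect_matching tail a M.
Proof.
move=> aM M1; rewrite /perfect_matching aM; apply/forallP=> v.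
by have [e [eM ev u]] := M1 v; apply/eqP/(degree1I eM).
Qed.

(* On a cycle C, this says that the edges of C alternate between M and its complement. *)
Definition alternating (M C : {set D}) := forall d, d \in M -> tail d \in vset C -> d \in C.

Lemma cycle_two C v : is_cycle tail a C -> v \in vset C ->
  exists d e, [/\ d \in C, e \in C, tail d = v, tail e = v & d != e].
Proof.
move=> cC vC; have /eqP/cards2P[d [e [de /setP E]]] := cycle_degree cC vC.
have := E d; have := E e; rewrite !inE !eqxx orbT => /andP[eC /eqP ev] /andP[dC /eqP dv].
by exists d, e.
Qed.

Lemma flip_perfect M C : is_cycle tail a C -> perfect_matching tail a M -> alternating M C ->
  perfect_matching tail a (symdiff M C).
Proof.
move=> cC pM alt; apply: perfectI => [|v].
  by apply: symdiff_aclosed; [apply: perfect_aclosed | apply: cycle_aclosed].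
have [m [mM mv mU]] := perfect_dart v pM.
have [vC|vC] := boolP (v \in vset C); last first.
  have nC x : tail x = v -> (x \in C) = false.
    by move=> xv; apply: contraNF vC => /mem_vset; rewrite xv.
  exists m; split=> // [|x]; first by rewrite in_symdiff mM nC.
  by rewrite in_symdiff => + xv; rewrite nC // addbF => /mU; apply.
have mC : m \in C by apply: alt; rewrite ?mv.
have /eqP := cycle_degree cC vC; rewrite /Defs.degree_in (cardsD1 m) !inE mC mv eqxx.
case/cards1P=> e /setP E; have := E e; rewrite !inE eqxx => /and3P[em eC /eqP ev].
exists e; split=> // [|x].
  rewrite in_symdiff eC addbT; apply: contra em => eM; exact/eqP/mU.
rewrite in_symdiff => + xv; have [-> /=|xm] := eqVneq x m; first by rewrite mM mC.
have -> : x \in M = false by apply: contraNF xm => /mU->.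
by move=> /= xC; have := E x; rewrite !inE xm xC xv eqxx => /esym/eqP.
Qed.

Lemma alternating_nice M C : is_cycle tail a C -> perfect_matching tail a M ->
  alternating M C -> nice_cycle tail a C.
Proof.
move=> cC pM alt; rewrite /nice_cycle cC; apply/existsP.
have aM := perfect_aclosed pM; have aC := cycle_aclosed cC.
have step d : d \in M -> tail d \in vset C -> tail (a d) \in vset C.
  by move=> dM /(alt d dM) dC; rewrite mem_vset // aclosedE.
exists [set d in M | tail d \notin vset C]; apply/and3P; split.
- apply/forallP=> d; rewrite !inE aclosedE //; case dM: (d \in M) => //=.
  apply/eqP; congr (~~ _); apply/idP/idP; last exact: step.
  by move=> h; rewrite -[d]aK; apply: step; rewrite ?aclosedE.
- by apply/forall_inP=> d; rewrite inE => /andP[].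
apply/forallP=> v; apply/implyP=> vC; have [m [mM mv mU]] := perfect_dart v pM.
apply/eqP/(degree1I (e := m)) => // [|x]; first by rewrite inE mM mv.
by rewrite inE => /andP[/mU].
Qed.

(** The cycle is the connected component of [d] in the symmetric difference. *)
Lemma symdiff_component M N d : perfect_matching tail a M -> perfect_matching tail a N ->
  d \in symdiff M N ->
  exists C, [/\ is_cycle tail a C, d \in C, C \subset symdiff M N & alternating M C].
Proof.
set Z := symdiff M N => pM pN dZ.
have aZ : aclosed Z by apply: symdiff_aclosed; apply: perfect_aclosed.
have inZ x : (x \in Z) = (x \in M) (+) (x \in N) by rewrite in_symdiff.
clearbody Z.
pose C := [set e in Z | connect (adjV tail a Z) (tail d) (tail e)].
have sub : C \subset Z by apply/subsetP=> e; rewrite inE => /andP[].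
have dC : d \in C by rewrite inE dZ connect0.
have aC : aclosed C.
  apply/forallP=> e; rewrite !inE aclosedE //; case eZ: (e \in Z) => //=; apply/eqP.
  by apply/idP/idP=> h; apply: connect_trans h _; apply: connect1; apply/adjVP;
    [exists (a e); rewrite ?aclosedE ?aK | exists e].
have vCZ e : e \in Z -> tail e \in vset C -> e \in C.
  by move=> eZ /imsetP[f]; rewrite !inE eZ => /andP[fZ fc] ->.
have conC x : connect (adjV tail a Z) (tail d) x -> connect (adjV tail a C) (tail d) x.
  move=> dx; apply: contraT => ndx.
  have [u [w [du ndw /adjVP[e eZ [eu ew]]]]] :=
    connect_exit (P := connect (adjV tail a C) (tail d)) dx (connect0 _ _) ndx.
  case/negP: ndw; apply: (connect_trans du); apply: connect1; apply/adjVP; exists e => //.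
  rewrite inE eZ eu; apply: connect_sub du => y z /adjVP[f fC fE].
  by apply: connect1; apply/adjVP; exists f => //; apply: (subsetP sub).
have symC : connect_sym (adjV tail a C).
  apply: sym_connect_sym => x y; apply/adjVP/adjVP => -[f fC [<- <-]];
    by exists (a f); rewrite ?aK // aclosedE.
exists C; split=> //.
  apply/and4P; split=> //; first by apply/set0Pn; exists d.
    apply/forallP=> v; have [vC|vC] := boolP (v \in vset C); last by rewrite cycle_degree0.
    apply/orP; right; have [m [mM mv mU]] := perfect_dart v pM.
    have [n [nN nv nU]] := perfect_dart v pN.
    have [e eC ev] := imsetP vC; have eZ := subsetP sub _ eC.
    (* If the two matchings shared their dart at [v], no dart of [Z] would start there; so [m] and
       [n] are exactly the darts of [Z] at [v]. *)
    have mn : m != n.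
      apply: contraTneq eZ => mn; rewrite inZ.
      have [eM|eM] := boolP (e \in M).
        by rewrite (mU e) // mn nN.
      apply/negP=> /nU/(_ (esym ev)) en; move: eM; rewrite en -mn mM //.
    have ZE x : tail x = v -> (x \in Z) = (x == m) || (x == n).
      move=> xv; rewrite inZ.
      have -> : (x \in M) = (x == m) by apply/idP/eqP=> [/mU->|->].
      have -> : (x \in N) = (x == n) by apply/idP/eqP=> [/nU->|->].
      by case: eqP => // ->; rewrite (negPf mn).
    apply/cards2P; exists m, n; split=> //; apply/setP=> x; rewrite in_set2 in_set.
    apply/andP/orP=> [[xC /eqP xv]|xmn].
      by apply/orP; rewrite -ZE // (subsetP sub).
    have xv : tail x = v by case: xmn => /eqP->.
    by rewrite xv eqxx; split=> //; apply: vCZ; rewrite ?xv // ZE //; apply/orP.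
  apply/forall_inP=> u /imsetP[e eC ->]; apply/forall_inP=> v /imsetP[f fC ->].
  move: eC fC; rewrite !inE => /andP[_ /conC eC] /andP[_ /conC fC].
  by apply: connect_trans fC; rewrite symC.
move=> e eM eC; apply: vCZ (eC); have [f fC ef] := imsetP eC.
have := subsetP sub _ fC; rewrite !inZ eM /=; apply: contraL => eN.
have fe : (f \in M) || (f \in N) -> f = e.
  by case/orP=> h; apply/esym; [apply: perfect_uniq eM h ef | apply: perfect_uniq eN h ef].
case fM: (f \in M) fe; case fN: (f \in N) => //= /(_ isT) fe.
  by move: fN; rewrite fe eN.
by move: fM; rewrite fe eM.
Qed.

(** * Sufficiency *)

Notation reach := (clos_refl_trans _ (res_adj tail a s d0)).

(** Flipping one cycle of the symmetric difference removes it from the difference. The premise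
    ranges over all [M'] because the current matching changes while the cycles stay in the original
    difference. *)
Lemma reach_symdiff M N : perfect_matching tail a M -> perfect_matching tail a N ->
  (forall M' C, perfect_matching tail a M' -> alternating M' C -> is_cycle tail a C ->
     C \subset symdiff M N -> reach M' (symdiff M' C)) ->
  reach M N.
Proof.
have [n] := ubnP #|symdiff M N|; elim: n M => // n IHn M leMN pM pN step.
have [MN0|/set0Pn[d dMN]] := eqVneq (symdiff M N) set0.
  suff -> : M = N by apply: rt_refl.
  apply/setP=> d; move/setP/(_ d): MN0; rewrite in_symdiff inE.
  by case: (d \in M); case: (d \in N).
have [C [cC dC sC altC]] := symdiff_component pM pN dMN.
have pMC := flip_perfect cC pM altC.
apply: rt_trans (step _ _ pM altC cC sC) _.
have sub : symdiff (symdiff M C) N \subset symdiff M N.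
  apply/subsetP=> x; have := subsetP sC x; rewrite !in_symdiff.
  by case: (x \in C) => [/(_ isT)->|_]; rewrite ?addbF.
apply: IHn => // [|M' C' pM' alt' cC' sC']; last exact: step (subset_trans sC' sub).
apply: leq_trans _ (leMN : _ <= n); apply: proper_card; rewrite properEneq sub andbT.
apply: contraTneq dMN => <-; have := subsetP sC _ dC; rewrite !in_symdiff dC.
by case: (d \in M); case: (d \in N).
Qed.

Lemma perfect_interior M C : is_cycle tail a C -> perfect_matching tail a M ->
  alternating M C ->
  perfect_matching_of tail a (interior_graph a s d0 C) (M :&: interior_graph a s d0 C).
Proof.
move=> cC pM alt; set H := interior_graph a s d0 C.
have aH : aclosed H := interior_aclosed C.
apply/and3P; split; first exact: subsetIr.
  by apply/forallP=> d; rewrite !in_setI (aclosedE _ aH) (aclosedE _ (perfect_aclosed pM)).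
apply/forall_inP=> v vH; have [m [mM mv mU]] := perfect_dart v pM.
apply/eqP/(degree1I (e := m)) => // [|x]; last by rewrite in_setI => /andP[/mU].
rewrite in_setI mM; have [vC|vC] := boolP (v \in vset C).
  by apply: (subsetP (cycle_sub_interior cC)); apply: alt; rewrite ?mv.
by rewrite -interior_vset ?mv.
Qed.

(** The edge of [M] at a vertex lies in [I[C]] exactly when the vertex does: on [C] by alternation,
    off [C] because all edges there are on one side. *)
Lemma perfect_glue M N C : is_cycle tail a C -> perfect_matching tail a M ->
  alternating M C -> perfect_matching_of tail a (interior_graph a s d0 C) N ->
  perfect_matching tail a (N :|: (M :\: interior_graph a s d0 C)).
Proof.
move=> cC pM alt pN; set H := interior_graph a s d0 C in pN *.
have aH : aclosed H := interior_aclosed C.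
have [sNH aN /forall_inP N1] := and3P pN; have aM := perfect_aclosed pM.
apply: perfectI => [|v].
  by apply/forallP=> d; rewrite !in_setU !in_setD !aclosedE.
have [m [mM mv mU]] := perfect_dart v pM.
have mH : (m \in H) = (v \in vset H).
  have [vC|vC] := boolP (v \in vset C); last by rewrite -mv interior_vset ?mv.
  have /(subsetP (cycle_sub_interior cC)) h : m \in C by apply: alt; rewrite ?mv.
  by rewrite -mv h mem_vset.
have [vH|vH] := boolP (v \in vset H).
  have [n [nN nv nU]] := degree1E (eqP (N1 v vH)).
  exists n; split=> // [|x]; first by rewrite in_setU nN.
  rewrite in_setU in_setD => /orP[/nU//|/andP[xH /mU xm xv]].
  by move: xH; rewrite xm // mH vH.
exists m; split=> // [|x]; first by rewrite in_setU in_setD mH vH mM orbT.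
rewrite in_setU in_setD => /orP[/(subsetP sNH) xH xv|/andP[_ /mU]//].
by case/negP: vH; rewrite -xv mem_vset.
Qed.

(** The number of these darts is the induction measure for sufficiency. *)
Definition inside C : {set D} := [set d | ~~ exterior a s d0 C d].

(** A walk through the exterior of [C] crosses only edges outside [I[C]], hence none of [C']. Equal
    interiors would give equal cycles by [jordan]. *)
Lemma inside_proper C C' : is_cycle tail a C -> is_cycle tail a C' ->
  C' \subset interior_graph a s d0 C -> C' != C -> #|inside C'| < #|inside C|.
Proof.
move=> cC cC' sub neq; apply: proper_card.
have ext_sub d : exterior a s d0 C d -> exterior a s d0 C' d.
  move=> ed; apply: contraT => ned.
  pose P x := exterior a s d0 C x ==> exterior a s d0 C' x.
  have [||u [w [Pu]]] := connect_exit (P := P) (ed : connect _ _ _).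
  - by rewrite /P !ext_d0.
  - by rewrite /P ed ned.
  rewrite /P negb_imply => /andP[ew nw] /orP[/eqP wE|/andP[/eqP wE uC]].
    by move: Pu ew nw; rewrite /P wE !ext_phi => /implyP h /h->.
  move: Pu ew nw; rewrite /P wE (ext_a cC uC) => /implyP h eu.
  have uC' : u \notin C'.
    by apply: contraL eu => /(subsetP sub); rewrite mem_interior.
  by rewrite (ext_a cC' uC') h.
rewrite properEneq andbC; apply/andP; split.
  by apply/subsetP=> d; rewrite !in_set; apply/contra/ext_sub.
apply: contraNneq neq => E; rewrite -(jordan cC) -(jordan cC').
have eE d : exterior a s d0 C' d = exterior a s d0 C d.
  by have /setP/(_ d) := E; rewrite !in_set => /negb_inj.
by apply/eqP/setP=> d; rewrite !in_set !eE.
Qed.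

(** Every dart of an interior face lies on [C] and has an exterior reverse. So the boundary of that
    face is a nonempty even subset of [C], hence all of [C]. *)
Lemma face_flip M C : is_cycle tail a C -> perfect_matching tail a M -> alternating M C ->
  interior_graph a s d0 C \subset C -> reach M (symdiff M C).
Proof.
move=> cC pM alt sHC; apply: rt_step; split=> //; first exact: flip_perfect.
have aC := cycle_aclosed cC.
have [d dC nd] : exists2 d, d \in C & ~~ exterior a s d0 C d.
  have /and4P[_ /set0Pn[c cC0] _ _] := cC.
  have [ec|] := boolP (exterior a s d0 C c); last by exists c.
  by exists (a c); [rewrite aclosedE | move: cC0; rewrite (mem_cycle cC) ec].
exists d; rewrite -/(symdiff _ _) symdiffK; split.
  by apply: contra nd => /(connect_invariant (f := exterior a s d0 C))<- //
    => [|u w /eqP<-]; rewrite ?ext_d0 // ext_phi.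
pose f := fconnect phi d.
have fphi e : f (phi e) = f e by rewrite /f -same_fconnect1_r //; apply: phi_inj.
have fext e : f e -> ~~ exterior a s d0 C e.
  by move/(connect_invariant (f := exterior a s d0 C))<- => // u w /eqP<-; rewrite ext_phi.
have fC e : f e -> e \in C by move=> /fext ne; apply: (subsetP sHC); rewrite inE ne.
have ff e : f e -> ~~ f (a e).
  move=> fe; apply: contraL (fC e fe) => /fext nae; rewrite (mem_cycle cC).
  by rewrite (negPf nae) (negPf (fext e fe)).
have fe : bd f = face_edges a s d.
  apply/setP=> e; rewrite !in_set -/(f e) -/(f (a e)).
  by case fe: (f e) (ff e) => // /(_ isT) /negPf->.
rewrite -fe; symmetry; apply: cycle_minimal (bd_aclosed f) _ (bd_even fphi) _ => //.
  apply/subsetP=> e; rewrite fe !in_set => /orP[/fC//|/fC].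
  by rewrite aclosedE.
by apply/set0Pn; exists d; rewrite fe !in_set connect0.
Qed.

(** At [tail e], [N] uses [e], so both darts of [C] would have to belong to [M]. *)
Lemma not_sub_symdiff M N C e : is_cycle tail a C -> perfect_matching tail a M ->
  perfect_matching tail a N -> e \in N -> e \notin C -> tail e \in vset C ->
  ~~ (C \subset symdiff M N).
Proof.
move=> cC pM pN eN eC ve; apply/negP=> /subsetP sub.
have [x [y [xC yC xd yd xy]]] := cycle_two cC ve.
have xM z : z \in C -> tail z = tail e -> z \in M.
  move=> zC ze; have := sub z zC; rewrite in_symdiff; apply: contraLR => zM.
  rewrite (negPf zM) /=; apply: contraNN eC => zN.
  by rewrite (perfect_uniq pN eN zN).
by case/eqP: xy; apply: (perfect_uniq pM); rewrite ?xM ?xd.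
Qed.

Lemma alternating_reach C M :
  (forall C, nice_cycle tail a C ->
     bipartite_sub tail a (interior_graph a s d0 C) /\
     elementary_sub tail a (interior_graph a s d0 C)) ->
  is_cycle tail a C -> perfect_matching tail a M -> alternating M C ->
  reach M (symdiff M C).
Proof.
move=> elem; have [n] := ubnP #|inside C|; elim: n C M => // n IHn C M leC cC pM alt.
set H := interior_graph a s d0 C.
have [sHC|/subsetPn[d dH dC]] := boolP (H \subset C); first exact: face_flip.
have [[c cH] [[N0 pN0] conn]] := elem C (alternating_nice cC pM alt).
rewrite -/H in cH pN0 conn.
have aH : aclosed H := interior_aclosed C.
have allowed := connected_allowed aH cH pN0 conn.
(* A walk in [I[C]] from [d] to [C] enters [C] by an edge off [C]; its reverse is [e]. *)
have [e [eH eC ve]] : exists e, [/\ e \in H, e \notin C & tail e \in vset C].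
  have [vd|vd] := boolP (tail d \in vset C); first by exists d.
  have /and4P[_ /set0Pn[x xC] _ _] := cC.
  have vx : tail x \in vset H.
    by apply: mem_vset; apply: (subsetP (cycle_sub_interior cC)).
  have [||u [w [uC wC /adjVP[f fH [fu fw]]]]] :=
    connect_exit (P := fun v => v \notin vset C) (conn _ _ (mem_vset dH) vx).
  - exact: vd.
  - by rewrite negbK mem_vset.
  rewrite -fw -fu in_set in uC wC fH *; have [fH' _] := andP fH.
  exists (a f); rewrite aclosedE // (negbNE wC); split=> //.
  by apply: contra uC; rewrite (aclosedE _ (cycle_aclosed cC)) => /mem_vset.
have /existsP[N' /andP[pN' eN']] := allowed e eH.
have pN := perfect_glue cC pM alt pN'.
rewrite -/H in pN; set N := _ :|: _ in pN.
have eN : e \in N by rewrite in_setU eN'.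
have pMC := flip_perfect cC pM alt.
have [sN'H _ _] := and3P pN'.
have NH x : x \notin H -> (x \in N) = (x \in M).
  move=> xH; rewrite in_setU in_setD xH /=.
  by case xN: (x \in N') => //=; rewrite (subsetP sN'H) in xH.
have CH := cycle_sub_interior cC.
have small M' C' : is_cycle tail a C' -> perfect_matching tail a M' -> alternating M' C' ->
    C' \subset H -> C' != C -> reach M' (symdiff M' C').
  move=> cC' pM' alt' C'H neq; apply: IHn => //.
  exact: leq_trans (inside_proper cC cC' C'H neq) _.
(* Both differences with [N] stay in [I[C]], and [e] keeps either from containing [C], so the
   induction hypothesis covers their cycles. *)
apply: (rt_trans _ _ _ N); apply: reach_symdiff => // M' C' pM' alt' cC' sub;
  apply: small => //.
- apply: subset_trans sub _; apply/subsetP=> x; rewrite in_symdiff.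
  by apply: contraLR => /NH->; rewrite addbb.
- by apply: contraTneq sub => ->; apply: not_sub_symdiff eN eC ve.
- apply: subset_trans sub _; apply/subsetP=> x; rewrite !in_symdiff.
  apply: contraLR => xH; have xC := contraNN (subsetP CH x) xH.
  by rewrite NH // (negPf xC) addbF addbb.
by apply: contraTneq sub => ->; rewrite symdiffC; apply: not_sub_symdiff eN eC ve.
Qed.

(** * Necessity *)

(** The handshake lemma modulo 2. *)
Lemma sum_odd_degree (z : {set D}) : aclosed z ->
  (\sum_v odd (degree_in z v) = 0 :> bool)%R.
Proof.
move=> az; rewrite -[RHS](odd_aclosed az) odd_card (partition_big tail xpredT) //=.
by apply: eq_bigr => v _; rewrite odd_card_cond.
Qed.

(** Extension by [false] off the representatives lets [sym_ext] read the value of an edge from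
    either of its darts. *)
Let ext_rep (x : {d | rep d} -> bool) (d : D) : bool :=
  if insub d is Some j then x j else false.
Let sym_ext (x : {d | rep d} -> bool) (d : D) : bool := ext_rep x d (+) ext_rep x (a d).

Let sym_ext_a x d : sym_ext x (a d) = sym_ext x d.
Proof. by rewrite /sym_ext aK addbC. Qed.

Let sym_ext_val x j : sym_ext x (val j) = x j.
Proof.
rewrite /sym_ext /ext_rep valK insubF ?addbF //.
by rewrite rep_a (valP j).
Qed.

(** By Fredholm's alternative for the incidence matrix of [C], some [X] inside [C] has odd degree
    exactly at the vertices of [C]: kernel vectors are constant on [C], and [C] has evenly many
    vertices. Degrees on [C] being at most 2, odd means 1, and [X] completes [M0]. *)
Lemma nice_alternating C : nice_cycle tail a C -> (exists M, perfect_matching tail a M) ->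
  exists2 M, perfect_matching tail a M & alternating M C.
Proof.
case/andP=> cC /existsP[M0 /and3P[aM0 /forall_inP M0C /forallP M01]] [P pP].
have aC := cycle_aclosed cC.
(* Modulo 2, the degrees of [M0] and [P] at a vertex sum to 1 exactly on [C]. *)
have evenC : (\sum_v (v \in vset C) = 0 :> bool)%R.
  rewrite -[RHS](sum_odd_degree aM0) -[LHS]addr0 -[X in (_ + X)%R](sum_odd_degree (perfect_aclosed pP)).
  rewrite -big_split; apply: eq_bigr => v _ /=.
  case/andP: pP => _ /forallP/(_ v)/eqP->.
  case vC: (v \in vset C).
    rewrite (_ : degree_in M0 v = 0) //; apply/eqP; rewrite cards_eq0; apply/eqP/setP=> d.
    rewrite !inE; apply/andP=> -[/M0C dC /eqP dv]; by rewrite dv vC in dC.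
  by have /implyP := M01 v; rewrite vC => /(_ isT)/eqP->.
pose A (j : {d | rep d}) v : bool :=
  ((val j \in C) * ((tail (val j) == v) + (tail (a (val j)) == v)))%R.
have [z Az|x xE] := @fredholm_alternative bool _ _ A (fun v => v \in vset C).
  have [c cC0] : exists c, c \in C by case/and4P: cC => _ /set0Pn.
  have zr d : rep d -> d \in C -> z (tail d) = z (tail (a d)).
    move=> rd dC; have := Az (exist (fun d => is_true (rep d)) d rd); rewrite /A /= dC.
    under eq_bigr do rewrite mul1r mulrC mulrDr.
    rewrite big_split /= !sum_eq => /eqP; rewrite addr_eq0 => /eqP->.
    by case: (z _).
  have zC v : v \in vset C -> z v = z (tail c).
    move=> vC; apply/esym; move: (cycle_connect cC (mem_vset cC0) vC).
    apply: connect_invariant => u w /adjVP[d dC [<- <-]].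
    have [/zr->//|] := boolP (rep d).
    by rewrite -rep_a => /zr; rewrite aK aclosedE // => ->.
  rewrite -[RHS](mul0r (z (tail c))) -[X in _ = (X * _)%R]evenC big_distrl; apply: eq_bigr => v _ /=.
  by have [/zC->|] := boolP (v \in vset C); rewrite ?mul0r.
pose X := [set d in C | sym_ext x d].
have aX : aclosed X by apply/forallP=> d; rewrite !in_set aclosedE // sym_ext_a.
have degX v : odd (degree_in X v) = (v \in vset C).
  rewrite odd_card_cond xE.
  rewrite (_ : \sum_j _ = \sum_(j : {d | rep d})
    (fun d => ((tail d == v) + (tail (a d) == v)) * (d \in X)) (val j))%R; last first.
    apply: eq_bigr => j _; rewrite /A in_set sym_ext_val.
    by case: (_ \in C); case: (x j); rewrite ?mulr0 ?mul0r ?mulr1 ?mul1r.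
  rewrite (sum_sig _ (fun d => ((tail d == v) + (tail (a d) == v)) * (d \in X)))%R.
  rewrite (@pairing_rep (fun d => tail d == v)); last by move=> d; rewrite aclosedE.
  rewrite big_mkcond; apply: eq_bigr => d _.
  by case: (tail d == v); rewrite ?mul0r ?mul1r.
have sXC : X \subset C by apply/subsetP=> d; rewrite in_set => /andP[].
exists (M0 :|: X); last first.
  by move=> d; rewrite in_setU => /orP[/M0C/negP//|/(subsetP sXC)].
rewrite /perfect_matching; apply/andP; split.
  by apply/forallP=> d; rewrite !in_setU (aclosedE _ aM0) (aclosedE _ aX).
apply/forallP=> v; have [vC|vC] := boolP (v \in vset C).
  have -> : degree_in (M0 :|: X) v = degree_in X v.
    apply: eq_card => d; rewrite !in_set; apply: andb_id2r => /eqP dv.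
    by case: (boolP (d \in M0)) => // /M0C; rewrite dv vC.
  have : degree_in X v <= 2.
    rewrite -(cycle_degree cC vC); apply: subset_leq_card; apply/subsetP=> d.
    by rewrite !in_set => /andP[/andP[-> _] ->].
  by move: (degX v); rewrite vC; case: (degree_in X v) => [|[|[|]]].
have -> : degree_in (M0 :|: X) v = degree_in M0 v.
  apply: eq_card => d; rewrite !in_set; apply: andb_id2r => /eqP dv.
  case: (boolP (d \in C)) => [/mem_vset|]; last by rewrite orbF.
  by rewrite dv (negPf vC).
by have /implyP := M01 v; apply.
Qed.

Lemma even_symdiff M N : perfect_matching tail a M -> perfect_matching tail a N ->
  even_set (symdiff M N).
Proof.
move=> pM pN v; rewrite odd_card_cond.
under eq_bigr do rewrite in_symdiff.
rewrite big_split /= -!odd_card_cond -!/(degree_in _ _).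
by case/andP: pM pN => _ /forallP/(_ v)/eqP-> /andP[_ /forallP/(_ v)/eqP->].
Qed.

Definition resonant_face d := exists M N, [/\ perfect_matching tail a M,
  perfect_matching tail a N & symdiff M N = face_edges a s d].

(** [face_edges] would also contain an edge with this face on both sides, but a bounding face set
    takes one value there, so such an edge is in no boundary. *)
Lemma face_edges_bd d : even_set (face_edges a s d) ->
  face_edges a s d = bd (fconnect phi d).
Proof.
move=> ev; have [|g [gphi _ E]] := even_set_bd _ ev.
  by apply/forallP=> e; rewrite !in_set aK orbC.
have gE e : fconnect phi d e -> g e = g d.
  by move/(connect_invariant (f := g))=> -> // u w /eqP<-.
apply/setP=> e; have /setP/(_ e) := E; rewrite !in_set.
case de: (fconnect phi d e); case dae: (fconnect phi d (a e)) => //=.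
by rewrite !gE // addbb.
Qed.

Lemma fconnect_phi_phi d e : fconnect phi d (phi e) = fconnect phi d e.
Proof. by rewrite -(same_fconnect1_r phi_inj). Qed.

(** Each step contributes the face it flips, never the outer one; composing paths adds the face sets
    modulo 2. *)
Lemma reach_faces M N : reach M N ->
  exists f : D -> bool, [/\ forall d, f (phi d) = f d, f d0 = false, symdiff M N = bd f &
    forall d, f d -> resonant_face d].
Proof.
elim=> {M N} [M N [pM pN [d [dd0 E]]]|M|M N P _ [f [fphi f0 fE fr]] _ [g [gphi g0 gE gr]]].
- have E' : symdiff M N = bd (fconnect phi d).
    by rewrite /symdiff E face_edges_bd // -E; apply: even_symdiff.
  exists (fconnect phi d); split=> // [e||e de].
  + exact: fconnect_phi_phi.
  + by rewrite (fconnect_sym phi_inj); apply/negbTE.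
  exists M, N; split=> //; rewrite /symdiff E; apply/setP=> x; rewrite !in_set.
  by rewrite !(same_connect (fconnect_sym phi_inj) de).
- exists (fun _ => false); split=> //; apply/setP=> d.
  by rewrite in_symdiff in_set addbb.
exists (fun d => f d (+) g d); split=> [d||| d].
- by rewrite fphi gphi.
- by rewrite f0 g0.
- apply/setP=> d; move/setP/(_ d): fE; move/setP/(_ d): gE.
  rewrite !in_symdiff !in_set.
  by case: (d \in M); case: (d \in N); case: (d \in P); case: (f d); case: (f (a d));
     case: (g d); case: (g (a d)).
by case fd: (f d) => /= gd; [apply: fr | apply: gr].
Qed.

Lemma card_perfect M : perfect_matching tail a M ->
  2 * (\sum_(d | rep d) (d \in M)) = #|V|.
Proof.
move=> pM; have aM := perfect_aclosed pM.
rewrite -cardsT -(perfect_matching_vset pM) card_in_imset; last first.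
  by move=> d e; apply: perfect_uniq.
rewrite -sum1_card [RHS]big_mkcond (sum_rep (fun d => if d \in M then 1 else 0)) big_distrr.
by apply: eq_bigr => d _; rewrite aclosedE //; case: (d \in M).
Qed.

(** Modulo 2, the length of the face is the number of edges of [M] plus that of [N], and these
    numbers are equal. *)
Lemma resonant_face_even d : resonant_face d -> (\sum_e fconnect phi d e = 0 :> bool)%R.
Proof.
case=> M [N [pM pN E]]; rewrite sum_rep.
have {}E : symdiff M N =i bd (fconnect phi d).
  by move=> e; rewrite E face_edges_bd // -E; apply: even_symdiff.
rewrite (eq_bigr (fun e => (e \in M) + (e \in N))%R); last first.
  by move=> e _; apply/esym; move: (E e); rewrite in_symdiff in_bd.
have /eqP := card_perfect pM; rewrite -(card_perfect pN) eqn_pmul2l // => /eqP/(congr1 odd).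
rewrite !odd_sum big_split /= => h.
have oddb (S : {set D}) :
    (\sum_(e | rep e) (e \in S) = \sum_(e | rep e) odd (e \in S) :> bool)%R.
  by apply: eq_bigr => e _; case: (e \in S).
by rewrite !oddb h; apply: addbb.
Qed.

(** By Fredholm's alternative, a 2-coloring exists once every even edge set [Z] of [I[C]] has evenly
    many edges. Such a [Z] bounds a set [g] of interior faces, so its size is modulo 2 a sum of even
    face lengths. *)
Lemma bipartite_of_even_faces C : is_cycle tail a C ->
  (forall d, ~~ exterior a s d0 C d -> (\sum_e fconnect phi d e = 0 :> bool)%R) ->
  bipartite_sub tail a (interior_graph a s d0 C).
Proof.
move=> cC even; set H := interior_graph a s d0 C.
have aH : aclosed H := interior_aclosed C.
pose A v (j : {d | rep d}) : bool :=
  ((val j \in H) * ((tail (val j) == v) + (tail (a (val j)) == v)))%R.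
have [z Az|x xE] := @fredholm_alternative bool _ _ A (fun j => val j \in H).
  pose Z := [set d in H | sym_ext z d].
  have inZ d : (d \in Z) = (d \in H) && sym_ext z d by rewrite in_set.
  have aZ : aclosed Z by apply/forallP=> d; rewrite !inZ (aclosedE _ aH) sym_ext_a.
  have evZ : even_set Z.
    move=> v; rewrite odd_card_cond; apply/negbT; rewrite -[RHS](Az v).
    rewrite [RHS](_ : _ = \sum_(j : {d | rep d})
      (fun d => ((tail d == v) + (tail (a d) == v)) * (d \in Z)) (val j))%R; last first.
      apply: eq_bigr => j _; rewrite /A inZ sym_ext_val.
      by case: (_ \in H); case: (z j); rewrite ?mulr0 ?mul0r ?mulr1 ?mul1r.
    rewrite (sum_sig _ (fun d => ((tail d == v) + (tail (a d) == v)) * (d \in Z)))%R.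
    rewrite (@pairing_rep (fun d => tail d == v)); last by move=> d; rewrite aclosedE.
    rewrite big_mkcond; apply: eq_bigr => d _.
    by case: (tail d == v); rewrite ?mul0r ?mul1r.
  have [g [gphi g0 ZE]] := even_set_bd aZ evZ.
  (* No exterior edge off [C] is in [Z], so [g] keeps its value [false] from the outer face
     throughout the exterior. *)
  have gext d : g d -> ~~ exterior a s d0 C d.
    move=> gd; apply/negP=> ed.
    suff : g d && exterior a s d0 C d = g d0 && exterior a s d0 C d0 by rewrite gd ed g0.
    apply: (ext_const (f := fun d => g d && exterior a s d0 C d)) ed => [e|e eC] /=.
      by rewrite gphi (ext_phi C).
    rewrite (ext_a cC eC); apply: andb_id2r => ee.
    have : e \notin Z by rewrite inZ (mem_interior cC eC) ee.
    by rewrite ZE in_bd; case: (g e); case: (g (a e)).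
  have -> : (\sum_j (val j \in H) * z j = \sum_d g d)%R.
    rewrite sum_rep -(sum_sig _ (fun d => g d + g (a d))%R); apply: eq_bigr => j _.
    have /setP/(_ (val j)) := ZE; rewrite inZ in_bd sym_ext_val => h.
    exact: h.
  rewrite (partition_big (froot phi) xpredT) //= big1 // => r _.
  have [gr|gr] := boolP (g r); last first.
    rewrite big1 // => d /eqP dr; apply/negbTE.
    by rewrite -(froot_phi_invariant gphi) dr.
  (* Darts are grouped by the root of their face; an [r] that is not a root labels an empty
     group. *)
  have [rr|rr] := eqVneq (froot phi r) r; last first.
    rewrite big1 // => d /eqP dr; case/eqP: rr; rewrite -dr.
    exact: (root_root (fconnect_sym phi_inj)).
  rewrite -[RHS](even r (gext r gr)) big_mkcond; apply: eq_bigr => d _.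
  rewrite -(froot_phi_invariant gphi d) -(root_connect (fconnect_sym phi_inj)) rr.
  by rewrite [RHS]eq_sym; case: eqP => // ->.
exists x; suff h d : rep d -> d \in H -> x (tail d) != x (tail (a d)).
  move=> d dH; have [/h->//|] := boolP (rep d).
  by rewrite -rep_a => /h; rewrite aK aclosedE // eq_sym; apply.
move=> rd dH; have := xE (exist (fun d => is_true (rep d)) d rd); rewrite /A /= dH.
under eq_bigr do rewrite mul1r mulrDr.
by rewrite big_split /= !sum_eq; case: (x _); case: (x _).
Qed.

Lemma interior_allowed C M (c : V -> bool) : is_cycle tail a C -> perfect_matching tail a M ->
  alternating M C ->
  (forall d, d \in interior_graph a s d0 C -> c (tail d) != c (tail (a d))) ->
  (forall d, d \in interior_graph a s d0 C -> exists2 N, perfect_matching tail a N & d \in N) ->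
  forall d, d \in interior_graph a s d0 C ->
  allowed_sub tail a (interior_graph a s d0 C) d.
Proof.
move=> cC pM altM; set H := interior_graph a s d0 C => cH allG.
have aH : aclosed H := interior_aclosed C.
have CH := subsetP (cycle_sub_interior cC).
pose MH := M :&: H.
have pMH : perfect_matching_of tail a H MH by apply: perfect_interior.
have mMH := perfect_matching_ofW pMH.
have arcH := alt_edge (c := c) pMH.
have arcB := alt_black aH cH pMH.
have mateC v : v \in vset C -> mate MH v \in vset C.
  move=> vC; have [m [mM mv _]] := perfect_dart v pM.
  have mC : m \in C by apply: altM; rewrite ?mv.
  have mMH' : m \in MH by rewrite in_setI mM CH.
  by rewrite -mv (mateE mMH mMH') mem_vset // aclosedE // cycle_aclosed.
have allC e : e \in C -> allowed_sub tail a H e.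
  move=> eC; apply/existsP; have [eM|eM] := boolP (e \in M).
    by exists MH; rewrite pMH in_setI eM CH.
  exists (symdiff M C :&: H); rewrite in_setI in_symdiff eC (negPf eM) (CH e eC) /= andbT.
  apply: perfect_interior => //; first exact: flip_perfect.
  move=> x; rewrite in_symdiff => + vx; case xM: (x \in M) => //= _.
  by apply: altM.
(* The edges of [C] are allowed, through [M] or [M + C], so arcs link all black vertices of [C]:
   either all of them are reached from [u'] or none is. *)
have conC u v : u \in vset C -> v \in vset C ->
    connect (alt H c MH) (black_end c MH u) (black_end c MH v).
  move=> uC vC; apply: (allowed_black_end aH cH pMH).
  apply: connect_sub (cycle_connect cC uC vC) => x y /adjVP[e eC eE].
  by apply: connect1; apply/adjVP; exists e => //; rewrite in_set allC // CH.
suff black d : d \in H -> c (tail d) -> allowed_sub tail a H d.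
  move=> d dH; have [|cd] := boolP (c (tail d)); first exact: black.
  rewrite -[d]aK; apply/allowed_a/black; first by rewrite aclosedE.
  by rewrite (color_a cH).
move=> dH cd; apply: (alt_allowed aH cH pMH dH cd).
have [N pN dN] := allG d dH; have mN := perfect_matchingW pN.
set u := tail d in cd *; set u' := mate MH (tail (a d)).
have uu' : mate MH (mate N u) = u' by rewrite (mateE mN dN).
have /andP[cu' u'H] : c u' && (u' \in vset H) by apply: arcB (arcH d dH cd).
have vN w : exists2 e, e \in N & tail e = w.
  by have [e [eN ew _]] := perfect_dart w pN; exists e.
have inH w e : w \in vset H -> w \notin vset C -> tail e = w -> e \in H.
  by move=> wH wC ew; rewrite -interior_vset ?ew.
have [/existsP[w0 /and3P[w0C cw0 uw0]]|noC] :=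
  boolP [exists w, [&& w \in vset C, c w & connect (alt H c MH) u' w]]; last first.
  (* The reached set avoids [C], so [N] stays in [I[C]] there; the composite of mates preserves it
     and sends [u] to [u']. *)
  pose X w := [&& c w, w \in vset H & connect (alt H c MH) u' w].
  suff /and3P[] : X u by [].
  apply: (inj_closed_backward (inj_comp (mate_inj mMH) (mate_inj mN))) => /= [w|].
    case/and3P=> cw wH uw; have [e eN ew] := vN w.
    have eH : e \in H.
      apply: inH ew => //; apply: contra noC => wC.
      by apply/existsP; exists w; rewrite wC cw.
    have arc : alt H c MH w (mate MH (mate N w)).
      by rewrite -ew (mateE mN eN); apply: arcH; rewrite ?ew.
    rewrite /X; have /andP[-> ->] := arcB _ _ arc.
    exact: connect_trans uw (connect1 arc).
  by rewrite uu' /X cu' u'H connect0.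
apply: contraT => nu.
(* Now the unreached set avoids [C]. The inverse composite preserves it and sends [u'] to [u], so
   [u'] would be unreached. *)
pose Y w := [&& c w, w \in vset H & ~~ connect (alt H c MH) u' w].
suff /and3P[_ _] : Y u' by rewrite connect0.
apply: (inj_closed_backward (inj_comp (mate_inj mN) (mate_inj mMH))) => /= [w|]; last first.
  by rewrite -uu' (mateK mMH) (mateK mN) /Y cd nu mem_vset.
case/and3P=> cw wH uw.
have wC : w \notin vset C.
  apply: contra uw => wC; apply: connect_trans uw0 _.
  by have := conC _ _ w0C wC; rewrite /black_end cw cw0.
have vC : mate MH w \notin vset C by apply: contra wC => /mateC; rewrite (mateK mMH).
have vH : mate MH w \in vset H by apply: (mate_vset pMH).
have [e eN ev] := vN (mate MH w).
have eH : e \in H by apply: inH ev.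
have aeH : a e \in H by rewrite aclosedE.
have cae : c (tail (a e)).
  by rewrite (color_a cH eH) ev (mate_color cH pMH) // negbK.
rewrite -ev (mateE mN eN) /Y cae mem_vset //=; apply: contra uw => uae.
apply: connect_trans uae (connect1 _).
by have := arcH _ aeH cae; rewrite aK ev (mateK mMH).
Qed.

(** A path from [M] to [M + C] writes [C] as the boundary of resonant faces; by [jordan] and
    [bd_inj] these are exactly the interior faces. *)
Lemma reach_interior C : (exists M, perfect_matching tail a M) ->
  resonance_connected tail a s d0 -> nice_cycle tail a C ->
  bipartite_sub tail a (interior_graph a s d0 C) /\
  elementary_sub tail a (interior_graph a s d0 C).
Proof.
move=> exM conn nC; have [cC _] := andP nC.
have [M pM altM] := nice_alternating nC exM.
have [f [fphi f0 fE fr]] := reach_faces (conn _ _ pM (flip_perfect cC pM altM)).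
rewrite symdiffK -(jordan cC) in fE.
have res d : ~~ exterior a s d0 C d -> resonant_face d.
  move=> nd; apply: fr; rewrite (bd_inj (g := fun d => ~~ exterior a s d0 C d) fphi) //.
  - by move=> e; rewrite (ext_phi C).
  - by rewrite f0 (ext_d0 C).
  apply/setP=> e; rewrite -fE !in_bd.
  by case: (exterior _ _ _ _ _); case: (exterior _ _ _ _ _).
have [c cH] : bipartite_sub tail a (interior_graph a s d0 C).
  by apply: bipartite_of_even_faces => // d /res/resonant_face_even.
split; first by exists c.
(* A dart of a resonant face lies in the symmetric difference of two perfect matchings, hence in one
   of them. *)
have edge d : ~~ exterior a s d0 C d ->
    exists N, [/\ perfect_matching tail a N, d \in N & a d \in N].
  move=> /res[N1 [N2 [pN1 pN2 /setP/(_ d)]]].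
  rewrite in_symdiff in_set connect0 /= => h.
  have [dN1|dN1] := boolP (d \in N1).
    by exists N1; rewrite aclosedE //; apply: perfect_aclosed.
  by rewrite (negPf dN1) in h; exists N2; rewrite aclosedE //; apply: perfect_aclosed.
have all := interior_allowed cC pM altM cH _.
split; first by exists (M :&: interior_graph a s d0 C); apply: perfect_interior.
move=> u v uH vH; apply: connect_sub (interior_connected cC uH vH) => x y /adjVP[d dH dE].
apply: connect1; apply/adjVP; exists d => //; rewrite in_set dH all // => e.
rewrite in_set => /orP[/edge[N [pN eN _]]|/edge[N [pN _]]]; first by exists N.
by rewrite aK; exists N.
Qed.

End Plane.

(* G = plane graph given by the genus-0 rotation system (V, D, tail, a, s),
   whose outer face is the face containing dart d0. *)
Theorem theorem3p2 (V D : finType) (tail : D -> V) (a s : D -> D) (d0 : D) :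
  plane_graph tail a s ->
  genus0 V a s ->
  (exists M : {set D}, perfect_matching tail a M) ->
  (resonance_connected tail a s d0 <->
   forall C : {set D}, nice_cycle tail a C ->
     bipartite_sub tail a (interior_graph a s d0 C) /\
     elementary_sub tail a (interior_graph a s d0 C)).
Proof.
move=> planeG genusG exM; split=> [conn C|elem M N pM pN].
  exact: reach_interior.
apply: reach_symdiff => // M' C pM' alt' cC _.
exact: alternating_reach.
Qed.
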